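(* There exist an absolute constant $c>0$ and an integer $s_0$ such that for every integer $s\geq s_0$ and all positive integers $k,t$, $$\operatorname{gr}_k(K_s,K_t)\leq \left(\frac{cs^3}{\ln s}\right)^{kt}.$$
   Context: A $k$-edge-coloring of $K_n$ assigns to each edge one of $k$ colors (not all colors need be used, and it need not be proper). A subgraph is rainbow if all its edges have distinct colors, and monochromatic if all its edges have the same color. For graphs $G,H$ and a positive integer $k$, the Gallai-Ramsey number $\operatorname{gr}_k(G,H)$ is the minimum integer $n$ such that every $k$-edge-coloring of the complete graph $K_n$ contains a rainbow copy of $G$ or a monochromatic copy of $H$. *)

(* Defs.v *)
From mathcomp Require Import all_boot.

Set Implicit Arguments.
Unset Strict Implicit.
Unset Printing Implicit Defensive.

Record sgraph := SGraph {
  vertex :> finType;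
  adj : rel vertex;
  adj_sym : symmetric adj;
  adj_irr : irreflexive adj }.

Definition edges (G : sgraph) : {set {set G}} :=
  [set e : {set G} | [exists x, exists y, adj x y && (e == [set x; y]%SET)]].

Definition complete_rel (n : nat) : rel 'I_n := fun x y => x != y.

Lemma complete_rel_sym n : symmetric (@complete_rel n).
Proof. by move=> x y; rewrite /complete_rel eq_sym. Qed.

Lemma complete_rel_irr n : irreflexive (@complete_rel n).
Proof. by move=> x; rewrite /complete_rel eqxx. Qed.

Definition K (n : nat) : sgraph :=
  SGraph (@complete_rel_sym n) (@complete_rel_irr n).

(* Not necessarily proper, not necessarily onto.  The function is total on
   vertex sets, but only its values on [edges F] are ever used. *)
Definition edge_coloring (k : nat) (F : sgraph) := {set F} -> 'I_k.

(* [f] exhibits a (not necessarily induced) copy of G in F; the edges of that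
   copy are the images [f @: e], for [e] an edge of G. *)
Definition is_copy (G F : sgraph) (f : G -> F) : Prop :=
  injective f /\ (forall x y : G, adj x y -> adj (f x) (f y)).

Definition has_rainbow_copy (k : nat) (F : sgraph) (c : edge_coloring k F)
    (G : sgraph) : Prop :=
  exists f : G -> F, is_copy f /\
    (forall e1 e2 : {set G}, e1 \in edges G -> e2 \in edges G ->
       c (f @: e1)%SET = c (f @: e2)%SET -> e1 = e2).

Definition has_monochromatic_copy (k : nat) (F : sgraph)
    (c : edge_coloring k F) (H : sgraph) : Prop :=
  exists f : H -> F, is_copy f /\
    (forall e1 e2 : {set H}, e1 \in edges H -> e2 \in edges H ->
       c (f @: e1)%SET = c (f @: e2)%SET).

Definition gallai_ramsey_property (k : nat) (G H : sgraph) (n : nat) : Prop :=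
  forall c : edge_coloring k (K n),
    has_rainbow_copy c G \/ has_monochromatic_copy c H.

(* gr_k(G, H) = n.  A relation, so that no junk value is needed when no
   integer has the property; [n] is unique when it exists. *)
Definition is_gallai_ramsey (k : nat) (G H : sgraph) (n : nat) : Prop :=
  gallai_ramsey_property k G H n /\
  (forall m : nat, gallai_ramsey_property k G H m -> (n <= m)%N).

(* Main.v *)
Require Import Defs.
From HB Require Import structures.
From mathcomp Require Import all_boot all_order all_algebra zify lra.
From mathcomp Require Import all_classical all_reals all_analysis.
From mathcomp Require Import fintype finset.

Set Implicit Arguments.
Unset Strict Implicit.
Unset Printing Implicit Defensive.

Import Order.TTheory GRing.Theory Num.Theory.

(* Follow a vertex into its largest colour neighbourhood, repeatedly: if each
   step costs at most a factor M, then M^(kt) vertices give a monochromatic K_t.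
   A step can only fail on a set W in which every colour degree is at most
   |W|/M, so one needs a rainbow K_s there, with M of order s^3/ln s.

   Sample q = s^(1+o(1)) vertices at random, so that two edges with the same
   colour rarely overlap in short cycles, and pick a uniformly random rainbow
   subset S of the sample.  Locally around a typical vertex v, the set S is a
   uniformly random subset of the vertices free to be added; so if y triples of
   S are expected to block v (a triple {a,b,c} with va, bc of the same colour),
   then v can be added with probability at least 2^(-O(y)).  If all rainbow sets
   have size less than s, then v can be added with probability at most about
   s/q, a negative power of s, so y is at least of order ln s.  But a triple
   blocks at most a fraction 1/M of the vertices, so y is at most s^3/M. *)

(** * Arithmetic of the parameters *)

(** In [(K * s ^ 3) ^ k <= (M * r) ^ k] one of the [3 * k = l.+1] factors [s] absorbs [r ^ (k + l)].
    Here [s * r] will be the sample size. *)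
Lemma power_le K M s r k l :
  0 < r -> r ^ 16 <= s -> K * s ^ 3 <= M * r -> l.+1 = 3 * k -> k + l <= 16 ->
  K ^ k * (s * r) ^ l <= M ^ k.
Proof.
move=> r0 rs Mr kl kl16; have rk0 : 0 < r ^ k by rewrite expn_gt0 r0.
rewrite -(leq_pmul2r rk0) -expnMn -mulnA.
apply: leq_trans (_ : (K * s ^ 3) ^ k <= _); last by rewrite leq_exp2r // lt0n; case: (k) kl.
rewrite [leqRHS]expnMn leq_mul2l -expnM -kl expnMn -mulnA -expnD expnSr leq_mul2l.
by apply/orP; right; apply/orP; right; apply: leq_trans rs; rewrite leq_pexp2l // addnC.
Qed.

(** After division by [M ^ 3] the right side is at most [N] times [81 / 352 + 777 / 352 ^ 2 + 2304 /
    352 ^ 2], which is below one half. *)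
Lemma union_bound_half K M q N b :
  0 < M -> 352 <= K -> K ^ 1 * q ^ 2 <= M ^ 1 -> K ^ 2 * q ^ 5 <= M ^ 2 -> K ^ 3 * q ^ 8 <= M ^ 3 ->
  b * M ^ 3 <= q ^ 2 * 81 * N * M ^ 2 + q ^ 5 * (3 * 256) * N * M + q ^ 5 * (3 * 3) * N * M
    + q ^ 8 * (3 * (3 * 256)) * N ->
  2 * b <= N.
Proof.
move=> M0 K352 K2 K5 K8 H.
have M3 : 0 < M ^ 3 by rewrite expn_gt0 M0.
have A1 : 352 * (q ^ 2 * M ^ 2) <= M ^ 3.
  by rewrite [leqRHS]expnS mulnA leq_mul // -[leqRHS]expn1 (leq_trans _ K2) // expn1 leq_mul.
have A2 : 352 * (352 * (q ^ 5 * M)) <= M ^ 3.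
  rewrite [leqRHS]expnSr !mulnA leq_mul // (leq_trans _ K5) // expnS expn1 -!mulnA.
  by rewrite !leq_mul.
have A3 : 352 * (352 * q ^ 8) <= M ^ 3.
  rewrite (leq_trans _ K8) // !(expnS K) expn0 muln1 -!mulnA.
  by apply: (leq_mul K352 (leq_mul K352 (leq_pmull _ _))); apply: leq_trans K352.
rewrite -(leq_pmul2r M3); move: A1 A2 A3 H => {K2 K5 K8 K352 M3}.
have E2 k : q ^ 2 * k * N * M ^ 2 = k * (N * (q ^ 2 * M ^ 2)).
  by move: (q ^ 2) (M ^ 2) => u v; lia.
have E5 k : q ^ 5 * k * N * M = k * (N * (q ^ 5 * M)) by move: (q ^ 5) => u; lia.
have E8 k : q ^ 8 * k * N = k * (N * q ^ 8) by move: (q ^ 8) => u; lia.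
rewrite E2 !E5 E8; move: (M ^ 3) (q ^ 8) (q ^ 2 * M ^ 2) (q ^ 5 * M) => m z x y.
move=> /(leq_mul (leqnn N)) A1 /(leq_mul (leqnn N)) A2 /(leq_mul (leqnn N)) A3.
rewrite [N * (352 * x)]mulnCA in A1.
rewrite [N * (352 * _)]mulnCA [N * (352 * _)]mulnCA in A2.
rewrite [N * (352 * _)]mulnCA [N * (352 * _)]mulnCA in A3.
rewrite -(mulnA 2).
by move: (N * x) (N * y) (N * z) (N * m) (b * m) A1 A2 A3; lia.
Qed.

(** * Resampling one coordinate of a random map *)

Section RandomMap.

Variables (V C I : finType) (col : V -> V -> C) (M : nat).
Hypothesis col_sym : forall x y, col x y = col y x.
Hypothesis col_deg : forall v c, #|[set w | col v w == c]| * M <= #|V|.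
Hypothesis V_gt0 : 0 < #|V|.

Implicit Types (f : {ffun I -> V}) (i z : I) (S : {set I}).

Definition upd f z v : {ffun I -> V} := [ffun x => if x == z then v else f x].

Lemma upd_same f z v : upd f z v z = v.
Proof. by rewrite ffunE eqxx. Qed.

Lemma upd_other f z v x : x != z -> upd f z v x = f x.
Proof. by rewrite ffunE => /negbTE ->. Qed.

(** The map [(f, v) |-> (upd f z v, f z)] is an involution, so resampling one coordinate preserves
    the uniform distribution. *)
Lemma big_upd (T : Type) (idx : T) (op : Monoid.com_law idx) z (G : {ffun I -> V} -> T) :
  \big[op/idx]_f \big[op/idx]_v G (upd f z v) =
  \big[op/idx]_f \big[op/idx]_(v : V) G f.
Proof.
rewrite pair_big /=.
pose h (p : {ffun I -> V} * V) := (upd p.1 z p.2, p.1 z).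
have hK : involutive h.
  move=> [f v]; rewrite /h /= upd_same; congr pair.
  by apply/ffunP => x; rewrite !ffunE; case: eqP => [->|].
rewrite (reindex_inj (inv_inj hK)) /=.
under eq_bigr => p _.
  have -> : upd (upd p.1 z p.2) z (p.1 z) = p.1.
    by have := hK p; case: p => f v; rewrite /h /= => -[].
  over.
by rewrite -(pair_bigA _ (fun f (v : V) => G f)).
Qed.

(** Independence of the event [P] from the coordinate [f z]. *)
Definition free_of z (P : pred {ffun I -> V}) :=
  forall f v, P (upd f z v) = P f.

(** With all coordinates but [f z] fixed, [f z] must lie in a single colour neighbourhood of [f x],
    a fraction at most [1 / M] of [V]. *)
Lemma card_colE z x (P : pred {ffun I -> V}) (g : {ffun I -> V} -> C) :
  x != z -> free_of z P -> (forall f v, g (upd f z v) = g f) ->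
  #|[pred f | P f && (col (f z) (f x) == g f)]| * M <= #|P|.
Proof.
have cardE (Q : pred {ffun I -> V}) : #|Q| = \sum_f Q f.
  by rewrite -sum1_card big_mkcond /=; apply: eq_bigr => f _; rewrite unfold_in; case: (Q f).
move=> xz Pz gz; rewrite -(leq_pmul2l V_gt0) mulnA !cardE !big_distrr /=.
under eq_bigr do rewrite -sum_nat_const; rewrite -(big_upd _ z) big_distrl /=.
apply: leq_sum => f _.
under eq_bigr do rewrite Pz upd_same upd_other // gz col_sym.
case: (P f) => /=; last by rewrite big1.
rewrite muln1; apply: leq_trans (col_deg (f x) (g f)).
rewrite leq_mul2r -sum1_card [leqRHS]big_mkcond /=.
by apply/orP; right; apply: leq_sum => v _; rewrite inE; case: eqP.
Qed.

(** * Conflicts and their probabilities *)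

(** Edges are pairs of distinct indices rather than of vertices: [f] need not be injective, and an
    edge collapsed by [f] takes its colour from the diagonal of [col]. *)
Definition conflict f a b c d :=
  [&& a != b, c != d, [set a; b] != [set c; d] & col (f a) (f b) == col (f c) (f d)].

Lemma conflict_swapl f a b c d : conflict f b a c d = conflict f a b c d.
Proof. by rewrite /conflict eq_sym setUC col_sym. Qed.

Lemma conflict_swapr f a b c d : conflict f a b d c = conflict f a b c d.
Proof. by rewrite /conflict [d == c]eq_sym [[set d; c]]setUC [col (f d) _]col_sym. Qed.

Lemma conflict_flip f a b c d : conflict f c d a b = conflict f a b c d.
Proof.
by rewrite /conflict [[set c; d] == _]eq_sym [col (f c) _ == _]eq_sym andbCA.
Qed.

Lemma card_conflict_l (P : pred {ffun I -> V}) a b c d :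
  a \notin [:: b; c; d] -> free_of a P ->
  #|[pred f | P f && conflict f a b c d]| * M <= #|P|.
Proof.
rewrite !inE !negb_or => /and3P[ab ac ad] Pa.
apply: leq_trans (card_colE (x := b) (g := fun f => col (f c) (f d)) _ Pa _).
- rewrite leq_mul2r subset_leq_card ?orbT //; apply/subsetP => f; rewrite !inE.
  by case/andP=> -> /and4P[_ _ _ ->].
- by rewrite eq_sym.
- by move=> f v; rewrite !upd_other // eq_sym.
Qed.

(** As [z] is an end of only one of the two edges, the symmetries of [conflict] make it the first
    index; the colour of its edge is then prescribed by the other edge. *)
Lemma card_conflict (P : pred {ffun I -> V}) z a b c d :
  z \in [:: a; b; c; d] -> (z \in [:: a; b]) != (z \in [:: c; d]) ->
  free_of z P -> #|[pred f | P f && conflict f a b c d]| * M <= #|P|.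
Proof.
have cardE (Q : pred {ffun I -> V}) : (fun f => conflict f a b c d) =1 Q ->
    #|[pred f | P f && conflict f a b c d]| = #|[pred f | P f && Q f]|.
  by move=> E; apply: eq_card => f; rewrite !inE -E.
have [E|ab] := eqVneq a b.
  rewrite (cardE pred0) => [|f]; last by rewrite /conflict E eqxx ?andbF.
  by rewrite eq_card0 // => f; rewrite !inE andbF.
have [E|cd] := eqVneq c d.
  rewrite (cardE pred0) => [|f]; last by rewrite /conflict E eqxx ?andbF.
  by rewrite eq_card0 // => f; rewrite !inE andbF.
rewrite !inE => /or4P[] /eqP ->; rewrite eqxx ?orbT /= => H Pz.
- apply: card_conflict_l => //; rewrite !inE (negbTE ab) /=.
  by case: (a == c) (a == d) H => [] [].
- rewrite (cardE (fun f => conflict f b a c d)) => [|f]; last by rewrite conflict_swapl.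
  apply: card_conflict_l => //; rewrite !inE eq_sym (negbTE ab) /=.
  by case: (b == c) (b == d) H => [] [].
- rewrite (cardE (fun f => conflict f c d a b)) => [|f]; last by rewrite conflict_flip.
  apply: card_conflict_l => //; rewrite !inE (negbTE cd) /=.
  by case: (c == a) (c == b) H => [] [].
- rewrite (cardE (fun f => conflict f d c a b)) => [|f].
  2: by rewrite -(conflict_flip f a) conflict_swapl.
  apply: card_conflict_l => //; rewrite !inE eq_sym (negbTE cd) /=.
  by case: (d == a) (d == b) H => [] [].
Qed.

Definition conflicting f (L : seq I) :=
  has (fun a => has (fun b => has (fun c => has (conflict f a b c) L) L) L) L.

Lemma conflictingP f (L : seq I) :
  reflect (exists a b c d, {subset [:: a; b; c; d] <= L} /\ conflict f a b c d)
          (conflicting f L).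
Proof.
apply: (iffP hasP) => [[a aL /hasP[b bL /hasP[c cL /hasP[d dL H]]]]|].
  exists a, b, c, d; split=> // x.
  by rewrite !inE => /or4P[] /eqP ->.
move=> [a [b [c [d [sub H]]]]].
have [aL bL cL dL] : [/\ a \in L, b \in L, c \in L & d \in L].
  by split; apply: sub; rewrite !inE eqxx ?orbT.
by exists a => //; apply/hasP; exists b => //; apply/hasP; exists c => //; apply/hasP; exists d.
Qed.

(* Two disjoint edges on {i, a, b, c}, in one of the three pairings, have the
   same colour. *)
Definition linked f i a b c :=
  uniq [:: i; a; b; c] &&
  has (fun t => conflict f i t.1.1 t.1.2 t.2) [:: (a, b, c); (b, a, c); (c, a, b)].

Lemma linked_swap f i a b c : linked f i a b c = linked f i a c b.
Proof.
rewrite /linked /= !orbF (conflict_swapr f i a b c) !inE [c == b]eq_sym.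
by case: (i == a) (i == b) (i == c) (a == b) (a == c) (b == c)
  (conflict f i a b c) (conflict f i b a c) (conflict f i c a b) => [] [] [] [] [] [] [] [] [].
Qed.

Lemma linked_rot f i a b c : linked f i a b c = linked f i b a c.
Proof.
rewrite /linked /= !orbF !inE [b == a]eq_sym (conflict_swapr f i c a b).
by case: (i == a) (i == b) (i == c) (a == b) (a == c) (b == c)
  (conflict f i a b c) (conflict f i b a c) (conflict f i c a b) => [] [] [] [] [] [] [] [] [].
Qed.

Lemma free_conflict z a b c d :
  z \notin [:: a; b; c; d] -> free_of z (fun f => conflict f a b c d).
Proof.
rewrite !inE !negb_or => /and4P[za zb zc zd] f v.
by rewrite /conflict !upd_other // eq_sym.
Qed.

Lemma free_conflicting z L :
  z \notin L -> free_of z (fun f => conflicting f L).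
Proof.
move=> zL f v; rewrite /conflicting.
apply: eq_in_has => a aL; apply: eq_in_has => b bL.
apply: eq_in_has => c cL; apply: eq_in_has => d dL.
apply: (@free_conflict z a b c d); apply: contra zL.
by rewrite !inE => /or4P[] /eqP ->.
Qed.

Lemma free_linked z i a b c :
  z \notin [:: i; a; b; c] -> free_of z (fun f => linked f i a b c).
Proof.
rewrite !inE !negb_or => /and4P[zi za zb zc] f v.
rewrite /linked; congr (_ && _); apply: eq_in_has => t.
by rewrite !inE => /or3P[] /eqP -> /=; apply: free_conflict; rewrite !inE !negb_or; apply/and4P.
Qed.

Lemma card_has (T : eqType) (L : seq T) (E : T -> pred {ffun I -> V}) m B :
  (forall a, a \in L -> #|E a| * m <= B) ->
  #|[pred f | has (E^~ f) L]| * m <= size L * B.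
Proof.
elim: L => [|a L IH] H /=; first by rewrite eq_card0.
rewrite mulSn; apply: leq_trans (leq_add (H a _) (IH _)); last 2 first.
- by rewrite mem_head.
- by move=> b bL; apply: H; rewrite inE bL orbT.
rewrite -mulnDl leq_mul2r -cardUI; apply/orP; right.
apply: leq_trans (leq_addr _ _); apply: subset_leq_card.
by apply/subsetP => f; rewrite !inE.
Qed.

Lemma card_conflicting L :
  #|[pred f | conflicting f L]| * M <= size L ^ 4 * #|{ffun I -> V}|.
Proof.
rewrite !expnS muln1 -!mulnA.
apply: (card_has
  (E := fun a f => has (fun b => has (fun c => has (conflict f a b c) L) L) L)) => a _.
apply: (card_has (E := fun b f => has (fun c => has (conflict f a b c) L) L)) => b _.
apply: (card_has (E := fun c f => has (conflict f a b c) L)) => c _.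
apply: (card_has (E := fun d f => conflict f a b c d)) => d _.
have [|] := boolP [&& a != b, c != d & [set a; b] != [set c; d]]; last first.
  move=> H; rewrite eq_card0 // => f; apply/negbTE; apply: contra H.
  by rewrite unfold_in => /and4P[-> -> ->].
case/and3P=> ab cd abcd.
(* Two distinct edges have an index belonging to only one of them; that index is resampled. *)
have [z zP zN] : exists2 z, z \in [:: a; b; c; d] & (z \in [:: a; b]) != (z \in [:: c; d]).
  have [aN|] := boolP (a \notin [:: c; d]).
    by exists a; rewrite ?(negbTE aN) mem_head.
  have [bN _|] := boolP (b \notin [:: c; d]).
    by exists b; rewrite ?(negbTE bN) !inE eqxx !orbT.
  rewrite !negbK => bP aP; case/eqP: abcd.
  apply/eqP; rewrite eqEcard !cards2 ab cd leqnn andbT; apply/subsetP => x.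
  by move: aP bP; rewrite !inE => aP bP /orP[] /eqP ->.
apply: leq_trans (card_conflict (P := predT) zP zN _).
  by rewrite leq_mul2r subset_leq_card ?orbT //; apply/subsetP => f; rewrite !inE.
by [].
Qed.

(** In each of the three pairings the two edges are disjoint, so any of the four indices can serve
    as the resampled one. *)
Lemma card_linked (P : pred {ffun I -> V}) z i a b c :
  z \in [:: i; a; b; c] -> free_of z P ->
  #|[pred f | P f && linked f i a b c]| * M <= 3 * #|P|.
Proof.
move=> zL Pz.
have [U|U] := boolP (uniq [:: i; a; b; c]); last first.
  by rewrite eq_card0 // => f; rewrite !inE /linked (negbTE U) andbF.
pose E t : pred {ffun I -> V} := [pred f | P f && conflict f i t.1.1 t.1.2 t.2].
have := card_has (L := [:: (a, b, c); (b, a, c); (c, a, b)]) (E := E) (m := M) (B := #|P|).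
move=> H; apply: leq_trans (H _) => {H}.
  rewrite leq_mul2r subset_leq_card ?orbT //; apply/subsetP => f.
  rewrite !inE => /andP[Pf /andP[_ /hasP[t tL H]]]; apply/hasP; exists t => //.
  by rewrite /E /= Pf.
move: U zL; rewrite /= !inE !negb_or => /and4P[/and3P[ia ib ic] /andP[ab ac] bc _] zL.
have rev (x y : I) : x != y -> (y == x) = false by rewrite eq_sym => /negbTE.
have E1 := (negbTE ia, negbTE ib, negbTE ic, negbTE ab, negbTE ac, negbTE bc).
have E2 := (rev _ _ ia, rev _ _ ib, rev _ _ ic, rev _ _ ab, rev _ _ ac, rev _ _ bc).
move=> t; rewrite !inE => /or3P[] /eqP ->; apply: (card_conflict (z := z)) => //;
  by move: zL; rewrite !inE => /or4P[] /eqP -> /=; rewrite ?eqxx ?E1 ?E2 ?orbT.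
Qed.

(** * Union bounds for short cycles of conflicts *)

Lemma card_exists (T : finType) (E : T -> pred {ffun I -> V}) m B :
  (forall a, #|E a| * m <= B) ->
  #|[pred f | [exists a, E a f]]| * m <= #|T| * B.
Proof.
move=> H; rewrite cardT; apply: leq_trans (card_has (L := enum T) (fun a _ => H a)).
rewrite leq_mul2r subset_leq_card ?orbT //; apply/subsetP => f; rewrite !inE.
by case/existsP=> a Ea; apply/hasP; exists a; rewrite ?mem_enum.
Qed.

(* Short cycles of conflicts through [i].  Each conflict has probability at most
   1/M given the vertices sampled so far, as soon as one of its indices is new;
   the side conditions provide such indices, so that the expected number of
   cycles is O(q^2/M + q^5/M^2 + q^8/M^3), and for q = s^(1+o(1)) it is small. *)
Definition bad1 f i := [exists p1, exists p2, conflicting f [:: i; p1; p2]].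

Definition bad2 f i :=
  [exists p1, exists p2, exists p3, exists r1, exists r2,
    [&& i \notin [:: p1; p2; r1; r2], conflicting f [:: p1; p2; r1; r2]
      & linked f i p1 p2 p3]].

Definition bad3 f i :=
  [exists p1, exists p2, exists p3, exists p4, exists p5,
    [&& p4 \notin [:: i; p1; p2; p3], linked f i p1 p2 p3
      & linked f i p1 p4 p5]].

Definition bad4 f i :=
  [exists u1, exists a1, exists b1, exists u2, exists a2, exists b2, exists x, exists y,
    [&& (i \notin [:: u1; u2; x; y]) && (a2 \notin [:: i; u1; a1; b1; u2; x; y]),
        conflicting f [:: u1; u2; x; y] && linked f i u1 a1 b1
      & linked f i u2 a2 b2]].

Definition bad f i := [|| bad1 f i, bad2 f i, bad3 f i | bad4 f i].

Local Notation q := #|I|.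
Local Notation NF := #|{ffun I -> V}|.

Lemma free_and z (P Q : pred {ffun I -> V}) :
  free_of z P -> free_of z Q -> free_of z (fun f => P f && Q f).
Proof. by move=> HP HQ f v; rewrite HP HQ. Qed.

Lemma card_side (b : bool) (P : pred {ffun I -> V}) m B :
  (b -> #|P| * m <= B) -> #|[pred f | b && P f]| * m <= B.
Proof.
by case: b => H; [exact: H | rewrite eq_card0].
Qed.

(** Chain rule for conditional probabilities: [a / b] is at most [k / m], and [b] is bounded in
    turn. *)
Lemma mul_bound_chain a b k m m' B : a * m <= k * b -> b * m' <= B -> a * (m * m') <= k * B.
Proof.
by move=> H H'; rewrite mulnA (leq_trans (leq_mul H (leqnn m'))) // -mulnA leq_mul2l H' orbT.
Qed.

Lemma card_bad1 i : #|[pred f | bad1 f i]| * M <= q ^ 2 * 81 * NF.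
Proof.
rewrite !expnS expn0 muln1 -!mulnA.
apply: card_exists => p1; apply: card_exists => p2.
exact: (card_conflicting [:: i; p1; p2]).
Qed.

Lemma card_bad2 i : #|[pred f | bad2 f i]| * M ^ 2 <= q ^ 5 * (3 * 256) * NF.
Proof.
rewrite -mulnn !(expnS q) expn0 muln1 -!mulnA.
do 5 (apply: card_exists => ?); apply: card_side => iN.
apply: mul_bound_chain (card_linked (mem_head _ _) (free_conflicting iN)) _.
exact: (card_conflicting [:: _; _; _; _]).
Qed.

Lemma card_bad3 i : #|[pred f | bad3 f i]| * M ^ 2 <= q ^ 5 * (3 * 3) * NF.
Proof.
rewrite -mulnn !(expnS q) expn0 muln1 -!mulnA.
do 5 (apply: card_exists => ?); apply: card_side => pN.
apply: mul_bound_chain (card_linked _ (free_linked pN)) _; first by rewrite !inE eqxx ?orbT.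
by apply: (card_linked (P := predT) (mem_head _ _)).
Qed.

(** Three conflicts are exposed in turn: the one among [u1], [u2], [x], [y], then the link through
    the fresh index [i], then the link through the fresh index [a2]. *)
Lemma card_bad4 i : #|[pred f | bad4 f i]| * M ^ 3 <= q ^ 8 * (3 * (3 * 256)) * NF.
Proof.
rewrite (expnS M) -mulnn !(expnS q) expn0 muln1 -!mulnA.
apply: card_exists => u1; apply: card_exists => a1; apply: card_exists => b1.
apply: card_exists => u2; apply: card_exists => a2; apply: card_exists => b2.
apply: card_exists => x; apply: card_exists => y.
apply: card_side => /andP[iN aN].
apply: mul_bound_chain (card_linked (z := a2) _ (free_and (free_conflicting _) (free_linked _))) _.
- by rewrite !inE eqxx ?orbT.
- by apply: contra aN; rewrite !inE => /or4P[] ->; rewrite ?orbT.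
- by apply: contra aN; rewrite !inE => /or4P[] ->; rewrite ?orbT.
apply: mul_bound_chain (card_linked (mem_head _ _) (free_conflicting iN)) _.
exact: (card_conflicting [:: _; _; _; _]).
Qed.

Lemma card_bad i :
  #|[pred f | bad f i]| * M ^ 3 <=
  q ^ 2 * 81 * NF * M ^ 2 + q ^ 5 * (3 * 256) * NF * M + q ^ 5 * (3 * 3) * NF * M
  + q ^ 8 * (3 * (3 * 256)) * NF.
Proof.
have arith a b1 b2 b3 b4 c1 c2 c3 c4 : a <= b1 + b2 + b3 + b4 ->
    b1 * M <= c1 -> b2 * M ^ 2 <= c2 -> b3 * M ^ 2 <= c3 -> b4 * M ^ 3 <= c4 ->
    a * M ^ 3 <= c1 * M ^ 2 + c2 * M + c3 * M + c4.
  move=> H H1 H2 H3 H4; apply: leq_trans (leq_mul H (leqnn _)) _.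
  rewrite !mulnDl leq_add // leq_add // ?leq_add //.
  - by rewrite expnS mulnA leq_mul.
  - by rewrite expnSr mulnA leq_mul.
  - by rewrite expnSr mulnA leq_mul.
apply: arith (card_bad1 i) (card_bad2 i) (card_bad3 i) (card_bad4 i).
have U (P Q : pred {ffun I -> V}) : #|[predU P & Q]| <= #|P| + #|Q|.
  by rewrite -cardUI leq_addr.
apply: leq_trans (_ : #|[predU [predU [predU [pred f | bad1 f i] & [pred f | bad2 f i]]
  & [pred f | bad3 f i]] & [pred f | bad4 f i]]| <= _).
  apply: subset_leq_card; apply/subsetP => f /or4P[] H.
  - by apply/orP; left; apply/orP; left; apply/orP; left.
  - by apply/orP; left; apply/orP; left; apply/orP; right.
  - by apply/orP; left; apply/orP; right.
  - by apply/orP; right.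
apply: leq_trans (U _ _) _; rewrite leq_add2r.
apply: leq_trans (U _ _) _; rewrite leq_add2r.
exact: U.
Qed.

(** * Conflicts around a good index *)

(** The indices that can take part in blocking [i]. *)
Definition attached f i u := [exists x, exists y, linked f i u x y].

(** Two attached indices in one conflict close a short cycle with their links to [i]. A link meeting
    the conflict again gives [bad2]; an index [a2] on the first link gives [bad3], or again [bad2];
    otherwise [a2] is fresh and [bad4] holds. *)
Lemma good_attached f i a b c d u1 u2 :
  ~~ bad f i -> conflict f a b c d -> i \notin [:: a; b; c; d] ->
  u1 \in [:: a; b; c; d] -> u2 \in [:: a; b; c; d] ->
  attached f i u1 -> attached f i u2 -> u1 = u2.
Proof.
move=> N abcd iN u1P u2P; move: N; rewrite !negb_or => /and4P[_ N2 N3 N4].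
move=> /existsP[a1 /existsP[b1 L1]] /existsP[a2 /existsP[b2 L2]].
apply/eqP/negPn/negP => u12.
(* The two edges of the conflict may share an index, so [x] and [y] may repeat [u1], [u2] or each
   other. *)
have [x [y E]] : exists x y, perm_eq [:: a; b; c; d] [:: u1; u2; x; y].
  have E1 := perm_to_rem u1P.
  have u2P' : u2 \in rem u1 [:: a; b; c; d].
    by move: u2P; rewrite (perm_mem E1) inE eq_sym (negbTE u12).
  have E2 := perm_to_rem u2P'.
  have := perm_size E2; have := perm_size E1.
  case E3 : (rem u2 _) E2 => [|x [|y [|? ?]]] //= E2 [<-] // _.
  exists x, y; apply: (perm_trans E1); rewrite perm_cons.
  exact: E2.
have sub : {subset [:: a; b; c; d] <= [:: u1; u2; x; y]} by move=> z; rewrite (perm_mem E).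
have conf4 p1 p2 r1 r2 p3 : [:: u1; u2; x; y] =i [:: p1; p2; r1; r2] ->
    linked f i p1 p2 p3 = false.
  move=> Ep; apply/negP => L; case/negP: N2.
  apply/existsP; exists p1; apply/existsP; exists p2; apply/existsP; exists p3.
  apply/existsP; exists r1; apply/existsP; exists r2.
  apply/and3P; split=> //; first by move: iN; rewrite (perm_mem E) Ep.
  by apply/conflictingP; exists a, b, c, d; split=> // z; rewrite (perm_mem E) Ep.
have E21 : [:: u1; u2; x; y] =i [:: u2; u1; x; y] by move=> z; rewrite !inE orbCA.
have u1N z : linked f i u1 u2 z = false by apply: (conf4 _ _ x y).
have u2N z : linked f i u2 u1 z = false by apply: (conf4 _ _ x y).
have xN z : linked f i u2 x z = false.
  by apply: (conf4 _ _ u1 y) => z'; rewrite !inE; do 4 case: (z' == _).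
have yN z : linked f i u2 y z = false.
  by apply: (conf4 _ _ u1 x) => z'; rewrite !inE; do 4 case: (z' == _).
have share p1 p2 p3 p4 p5 : linked f i p1 p2 p3 -> linked f i p1 p4 p5 ->
    p4 \in [:: p2; p3].
  move=> L L'; apply/negPn/negP => p4N; case/negP: N3.
  apply/existsP; exists p1; apply/existsP; exists p2; apply/existsP; exists p3.
  apply/existsP; exists p4; apply/existsP; exists p5; apply/and3P; split=> //.
  move: L'; rewrite /linked /= !inE !negb_or => /andP[/and3P[/and3P[_ ip4 _] /andP[p14 _] _] _].
  by rewrite eq_sym ip4 eq_sym p14 -negb_or; move: p4N; rewrite !inE.
case/negP: N4.
apply/existsP; exists u1; apply/existsP; exists a1; apply/existsP; exists b1.
apply/existsP; exists u2; apply/existsP; exists a2; apply/existsP; exists b2.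
apply/existsP; exists x; apply/existsP; exists y.
apply/and3P; split=> //; last first.
  by rewrite L1 andbT; apply/conflictingP; exists a, b, c, d.
apply/andP; split; first by move: iN; rewrite (perm_mem E).
have a2N z : a2 = z -> linked f i u2 z b2 by move=> <-.
rewrite !inE !negb_or; apply/and5P; split.
- by apply/eqP => E0; move: L2; rewrite /linked /= !inE E0 eqxx orbT.
- by apply/eqP => /a2N; rewrite u2N.
- apply/eqP => /a2N; rewrite linked_rot => L.
  have := share _ _ _ _ _ L; rewrite linked_rot in L1.
  move=> /(_ _ _ L1); rewrite !inE (negbTE u12) /= => /eqP E1.
  by move: (L2); rewrite -E1 linked_swap u2N.
- apply/eqP => /a2N; rewrite linked_rot => L.
  have := share _ _ _ _ _ L; rewrite linked_swap linked_rot in L1.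
  move=> /(_ _ _ L1); rewrite !inE (negbTE u12) /= => /eqP E1.
  by move: (L2); rewrite -E1 linked_swap u2N.
- by apply/and3P; split; apply/eqP => /a2N; rewrite ?xN ?yN // /linked /= !inE eqxx ?andbF.
Qed.

Definition rainbow f S := ~~ conflicting f (enum S).

Lemma rainbowP f S :
  reflect (forall a b c d, {subset [:: a; b; c; d] <= S} -> ~~ conflict f a b c d)
          (rainbow f S).
Proof.
apply: (iffP idP) => [H a b c d sub|H].
  apply: contra H => abcd; apply/conflictingP; exists a, b, c, d.
  by split=> // x /sub; rewrite mem_enum.
apply/negP => /conflictingP[a [b [c [d [sub abcd]]]]].
by move: abcd; apply/negP/H => x /sub; rewrite mem_enum.
Qed.

Lemma rainbowS f S S' : S \subset S' -> rainbow f S' -> rainbow f S.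
Proof.
move=> /subsetP sub /rainbowP H; apply/rainbowP => a b c d sub'.
by apply: H => x /sub'/sub.
Qed.

Definition crossing f i (t : I * I * I) :=
  uniq [:: i; t.1.1; t.1.2; t.2] && conflict f i t.1.1 t.1.2 t.2.

Definition triple_in S (t : I * I * I) := [&& t.1.1 \in S, t.1.2 \in S & t.2 \in S].

(** A conflict through [i] whose edges share an index lives on [i] and at most two further indices,
    which is [bad1]. *)
Lemma good_conflict_uniq f i a b c d :
  ~~ bad f i -> conflict f a b c d -> i \in [:: a; b; c; d] -> uniq [:: a; b; c; d].
Proof.
move=> N abcd iL; apply/negPn/negP => U; case/negP: N.
have iL' : i \in undup [:: a; b; c; d] by rewrite mem_undup.
have E := perm_to_rem iL'.
have lt4 : size (rem i (undup [:: a; b; c; d])) < 3.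
  have := ltn_size_undup [:: a; b; c; d]; rewrite (perm_size E) U => lt4.
  by rewrite -ltnS.
apply/or4P; constructor 1.
have [p1 [p2 sub]] : exists p1 p2, {subset rem i (undup [:: a; b; c; d]) <= [:: p1; p2]}.
  case: (rem _ _) lt4 => [|p1 [|p2 [|? ?]]] // _.
  - by exists i, i.
  - by exists p1, p1 => x; rewrite !inE => ->.
  - by exists p1, p2.
apply/existsP; exists p1; apply/existsP; exists p2; apply/conflictingP.
exists a, b, c, d; split=> // x; rewrite -mem_undup (perm_mem E) !(inE, in_cons i).
by case/predU1P => [->|/sub]; rewrite ?inE ?eqxx // => ->; rewrite orbT.
Qed.

Lemma crossing_attached f i t x :
  crossing f i t -> x \in [:: t.1.1; t.1.2; t.2] -> attached f i x.
Proof.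
case: t => [[a b] c] /andP[/= U H].
have L : linked f i a b c by rewrite /linked /= U H.
rewrite !inE => /or3P[] /eqP ->; apply/existsP.
- by exists b; apply/existsP; exists c.
- by exists a; apply/existsP; exists c; rewrite linked_rot.
- by exists a; apply/existsP; exists b; rewrite linked_rot linked_swap.
Qed.

(** A new conflict uses [i], has four distinct indices because [i] is good, and can be arranged with
    [i] first: it is a crossing triple inside [S]. *)
Lemma good_add f i S :
  ~~ bad f i -> rainbow f S -> i \notin S ->
  (forall t, crossing f i t -> ~~ triple_in S t) -> rainbow f (i |: S).
Proof.
move=> N /rainbowP RS iS H; apply/rainbowP => a b c d sub.
apply/negP => abcd.
have subN x : x \in [:: a; b; c; d] -> x != i -> x \in S.
  by move=> /sub; rewrite !inE => /predU1P[->|]; rewrite ?eqxx.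
have [iL|iL] := boolP (i \in [:: a; b; c; d]); last first.
  move: abcd; apply/negP/RS => x xL; apply: subN => //.
  by apply: contraNneq iL => <-.
have U := good_conflict_uniq N abcd iL.
have K x y z : perm_eq [:: a; b; c; d] [:: i; x; y; z] -> conflict f i x y z -> False.
  move=> E C1; move: (U); rewrite (perm_uniq E) => U'.
  have /negP := H (x, y, z) (introT andP (conj U' C1)); apply.
  move: U' => /andP[]; rewrite !inE !negb_or => /and3P[ix iy iz] _.
  by apply/and3P; split; apply: subN; rewrite 1?eq_sym // (perm_mem E) !inE eqxx ?orbT.
have pE (L L' : seq I) : (forall x, count_mem x L = count_mem x L') -> perm_eq L L'.
  by move=> e; apply/allP => x _; rewrite /= e.
move: iL; rewrite !inE => /or4P[] /eqP iE.
- by apply: (K b c d); rewrite iE ?perm_refl.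
- apply: (K a c d); rewrite iE; last by rewrite conflict_swapl.
  by apply: pE => x /=; lia.
- apply: (K d a b); rewrite iE; last by rewrite conflict_flip.
  by apply: pE => x /=; lia.
- apply: (K c a b); rewrite iE; last by rewrite -(conflict_flip f a) conflict_swapl in abcd *.
  by apply: pE => x /=; lia.
Qed.

(** A conflict inside [S0 :|: T] avoids [i], hence contains at most one index of [T] by
    [good_attached]. The attached indices can thus be chosen independently of each other. *)
Lemma good_split f i (S0 T : {set I}) :
  let A := [set u | attached f i u] in
  ~~ bad f i -> i \notin S0 -> rainbow f S0 -> T \subset A ->
  rainbow f (S0 :|: T) = (T \subset [set u in A | rainbow f (u |: S0)]).
Proof.
move=> A N iS0 RS0 TA; apply/idP/subsetP => [R u uT|H].
  rewrite inE (subsetP TA) //; apply: rainbowS R.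
  by rewrite setUC setUS // sub1set.
apply/rainbowP => a b c d sub; apply/negP => abcd.
have iA : i \notin A.
  by rewrite inE; apply/negP => /existsP[x /existsP[y /andP[/= /andP[]]]]; rewrite !inE eqxx.
have iL : i \notin [:: a; b; c; d].
  by apply/negP => /sub; rewrite inE (negbTE iS0) => /(subsetP TA); rewrite (negbTE iA).
have [/hasP[u uL uT]|/hasPn nT] := boolP (has (mem T) [:: a; b; c; d]); last first.
  move/rainbowP: RS0 => /(_ a b c d); rewrite abcd => /(_ _)/negP; apply => // x xL.
  by move: (sub x xL) (nT x xL); rewrite inE /= => /orP[] // ->.
have := H u uT; rewrite inE => /andP[uA /rainbowP/(_ a b c d)]; rewrite abcd.
move=> /(_ _)/negP; apply => // x xL; rewrite !inE.
move: (sub x xL); rewrite inE => /orP[->|xT]; first by rewrite orbT.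
apply/orP; left; apply/eqP; apply: (good_attached N abcd iL) => //.
  by have := subsetP TA x xT; rewrite inE.
by rewrite inE in uA.
Qed.

(** * Counting rainbow sets around a good index *)

Lemma card_between (B D : {set I}) :
  B \subset D -> #|[set T : {set I} | (B \subset T) && (T \subset D)]| * 2 ^ #|B| = 2 ^ #|D|.
Proof.
move=> BD.
have -> : [set T : {set I} | (B \subset T) && (T \subset D)] =
    [set B :|: T | T in powerset (D :\: B)].
  apply/setP => T; rewrite inE; apply/andP/imsetP => [[BT TD]|[T']].
    exists (T :\: B); first by rewrite inE setSD.
    by rewrite setDE setUIr setUCr setIT; apply/esym/setUidPr.
  rewrite inE subsetD => /andP[T'D _] ->.
  by rewrite subsetUl subUset BD.
rewrite card_in_imset ?card_powerset => [|T T'].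
  by rewrite -expnD cardsD (setIidPr BD) subnK // subset_leq_card.
rewrite !inE !subsetD => /andP[_ dT] /andP[_ dT'] E.
have K (X : {set I}) : [disjoint X & B] -> X = (B :|: X) :\: B.
  by move=> dX; rewrite setDUl setDv set0U; apply/esym/setDidPl.
by rewrite (K T dT) E -(K T' dT').
Qed.

(** For a uniformly random rainbow set avoiding [i], [num_extendable / num_avoiding] is the
    probability that [i] can be added and [num_blocks / num_avoiding] the expected number of
    blocking triples. *)
Definition num_avoiding f i := \sum_(S : {set I} | (i \notin S) && rainbow f S) 1.
Definition num_extendable f i :=
  \sum_(S : {set I} | (i \notin S) && rainbow f S) (rainbow f (i |: S) : nat).
Definition num_blocks f i :=
  \sum_(S : {set I} | (i \notin S) && rainbow f S)
     #|[set t | crossing f i t & triple_in S t]|.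

Lemma triple_in_sub S t : triple_in S t = ([set t.1.1; t.1.2; t.2] \subset S).
Proof. by rewrite !subUset !sub1set -andbA. Qed.

(* Condition on the part [S0] of the rainbow set outside the indices attached to
   [i]: the rest is then an arbitrary subset of the free attached indices [Fr].
   Each crossing triple of [Fr] lies in 1/8 of these subsets, and dropping the
   first index of every such triple leaves room for [i]; the two terms on the
   right correspond to at least [Y] and to fewer than [Y] crossing triples. *)
Lemma good_count f i Y :
  ~~ bad f i ->
  Y * num_avoiding f i <= 8 * num_blocks f i + Y * 2 ^ Y * num_extendable f i.
Proof.
move=> N; rewrite /num_avoiding /num_extendable /num_blocks !big_distrr -big_split /=.
pose A := [set u | attached f i u].
have iA : i \notin A.
  by rewrite inE; apply/negP => /existsP[x /existsP[y /andP[/= /andP[]]]]; rewrite !inE eqxx.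
pose Q (S0 : {set I}) := [&& i \notin S0, rainbow f S0 & [disjoint S0 & A]].
have PQ S : (i \notin S) && rainbow f S -> Q (S :\: A).
  case/andP=> iS RS; apply/and3P; split.
  - by rewrite inE (negbTE iS) andbF.
  - exact: rainbowS (subsetDl _ _) RS.
  - by rewrite -setI_eq0 setIDAC setDIl setDv setI0.
rewrite (partition_big (fun S => S :\: A) Q PQ) [leqRHS](partition_big (fun S => S :\: A) Q PQ) /=.
apply: leq_sum => S0 /and3P[iS0 RS0 dS0].
pose Fr := [set u in A | rainbow f (u |: S0)].
have FrA : Fr \subset A by apply/subsetP => u; rewrite inE => /andP[].
have reix g : \sum_(S : {set I} | ((i \notin S) && rainbow f S) && (S :\: A == S0)) g S =
    \sum_(T : {set I} | T \subset Fr) g (S0 :|: T) :> nat.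
  rewrite (reindex_onto (fun T => S0 :|: T) (fun S => S :&: A)) /=; last first.
    by move=> S /andP[_ /eqP <-]; rewrite setUC setID.
  apply: eq_bigl => T.
  rewrite !inE negb_or iS0 setDUl setIUl.
  have /setDidPl -> := dS0; have /disjoint_setI0 -> := dS0.
  rewrite set0U; have [/eqP/setIidPl TA|TA] := boolP (T :&: A == T); last first.
    rewrite andbF; apply/esym/negP => TF; case/negP: TA.
    by apply/eqP/setIidPl/(subset_trans TF).
  rewrite andbT (good_split N iS0 RS0 TA) -/A -/Fr.
  have -> : T :\: A = set0 by apply/eqP; rewrite setD_eq0.
  rewrite setU0 eqxx andbT.
  have -> : i \notin T by apply: contra iA; apply: subsetP.
  by [].
rewrite !reix.
pose D := [set t | crossing f i t & triple_in Fr t].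
have cardFr : \sum_(T : {set I} | T \subset Fr) 1 = 2 ^ #|Fr|.
  by rewrite sum1_card -card_powerset; apply: eq_card => T; rewrite inE.
have [leY|ltY] := leqP Y #|D|.
  apply: leq_trans (_ : \sum_(T : {set I} | T \subset Fr) 8 * #|[set t in D | triple_in T t]| <= _);
    last first.
    apply: leq_sum => T TF; apply: leq_trans (leq_addr _ _); rewrite leq_mul2l /=.
    apply: subset_leq_card; apply/subsetP => t; rewrite !inE => /andP[/andP[-> _]] /=.
    by rewrite !triple_in_sub => /subset_trans; apply; apply: subsetUr.
  rewrite -[leqRHS]big_distrr /=.
  have -> : \sum_(T : {set I} | T \subset Fr) #|[set t in D | triple_in T t]| =
      \sum_(t in D) #|[set T : {set I} | ([set t.1.1; t.1.2; t.2] \subset T) && (T \subset Fr)]|.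
    transitivity (\sum_(T : {set I} | T \subset Fr) \sum_(t in D | triple_in T t) 1).
      by apply: eq_bigr => T _; rewrite -sum1_card; apply: eq_bigl => t; rewrite inE.
    rewrite (exchange_big_dep (mem D)) /=; last by move=> T t _ /andP[].
    apply: eq_bigr => t tD; rewrite -sum1_card; apply: eq_bigl => T.
    by rewrite tD triple_in_sub inE andbC.
  rewrite big_distrr /= -big_distrr /= cardFr.
  apply: leq_trans (leq_mul leY (leqnn _)) _.
  rewrite -sum_nat_const; apply: leq_sum => t; rewrite inE => /andP[/andP[U _] tF].
  rewrite triple_in_sub in tF.
  have c3 : #|[set t.1.1; t.1.2; t.2]| = 3.
    move: U; rewrite /= !inE !negb_or => /and3P[_ /andP[ab ac] /andP[bc _]].
    by rewrite setUC cardsU1 cards2 !inE negb_or eq_sym ac eq_sym bc ab.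
  by have := card_between tF; rewrite c3 => <-; rewrite mulnC.
(* Deleting [H] removes fewer than [Y] indices, so at least a fraction [2 ^ -Y] of the subsets of
   [Fr] survives. *)
pose H := [set t.1.1 | t in D].
have leH : #|H| <= #|D| by apply: leq_imset_card.
have HF : H \subset Fr.
  by apply/subsetP => u /imsetP[t0 t0D ->]; move: t0D; rewrite inE => /andP[_ /and3P[]].
apply: leq_trans (_ : \sum_(T : {set I} | T \subset Fr :\: H) Y * 2 ^ Y <= _); last first.
  rewrite [leqRHS](bigID (fun T : {set I} => T \subset Fr :\: H)) /=.
  apply: leq_trans (leq_addr _ _).
  rewrite [leqRHS](eq_bigl (fun T : {set I} => T \subset Fr :\: H)).
    apply: leq_sum => T; rewrite subsetD => /andP[TF TH].
    apply: leq_trans (leq_addl _ _); rewrite leq_pmulr // lt0b.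
    apply: good_add => //.
    - by rewrite (good_split N iS0 RS0 (subset_trans TF FrA)).
    - rewrite inE negb_or iS0; apply: contra iA; exact: (subsetP (subset_trans TF FrA)).
    move=> t Ct; apply/negP => /and3P[w1 w2 w3].
    (* The indices of a crossing triple are attached, and [S0] contains no attached index. *)
    have inT x : x \in [:: t.1.1; t.1.2; t.2] -> x \in S0 :|: T -> x \in T.
      move=> xt; rewrite inE => /orP[xS|//].
      by have := disjointFr dS0 xS; rewrite inE (crossing_attached Ct xt).
    have w1' : t.1.1 \in T by apply: inT => //; rewrite !inE eqxx.
    have w2' : t.1.2 \in T by apply: inT => //; rewrite !inE eqxx ?orbT.
    have w3' : t.2 \in T by apply: inT => //; rewrite !inE eqxx ?orbT.
    suff : t.1.1 \in H by rewrite (disjointFr TH w1').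
    apply/imsetP; exists t => //; rewrite inE Ct /=.
    by apply/and3P; split; apply: (subsetP TF).
  by move=> T; rewrite andb_idl // subsetD => /andP[].
rewrite -big_distrr -[leqRHS]big_distrr /= leq_mul2l cardFr sum_nat_const.
have -> : #|[pred T : {set I} | T \subset Fr :\: H]| = 2 ^ #|Fr :\: H|.
  by rewrite -card_powerset; apply: eq_card => T; rewrite !inE.
rewrite -expnD leq_exp2l // cardsD (setIidPr HF).
by apply/orP; right; have := subset_leq_card HF; lia.
Qed.

(** * Averaging over maps and indices *)

Lemma free_rainbow i S : i \notin S -> free_of i (fun f => rainbow f S).
Proof.
by move=> iS f v; rewrite /rainbow free_conflicting // mem_enum.
Qed.

Lemma num_avoiding_upd f i v : num_avoiding (upd f i v) i = num_avoiding f i.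
Proof.
by apply: eq_bigl => S; have [|iS] := boolP (i \in S) => //=; rewrite free_rainbow.
Qed.

Lemma rainbow0 f : rainbow f set0.
Proof. by apply/rainbowP => a b c d /(_ a); rewrite !inE eqxx => /(_ isT). Qed.

Lemma num_avoiding_gt0 f i : 0 < num_avoiding f i.
Proof. by rewrite /num_avoiding (bigD1 set0) //= rainbow0 inE. Qed.

(** For a fixed triple [(a, b, c)] of [S], the new value of [f i] must be joined to [f a] in the
    colour between [f b] and [f c], which holds for at most [#|V| / M] vertices; [S] has at most
    [s ^ 3] triples. *)
Lemma sum_num_blocks f i s :
  (forall S, rainbow f S -> #|S| <= s) ->
  (\sum_v num_blocks (upd f i v) i) * M <= num_avoiding f i * (s ^ 3 * #|V|).
Proof.
move=> Hs; rewrite /num_avoiding [leqRHS]big_distrl /=.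
have -> : \sum_v num_blocks (upd f i v) i =
    \sum_(S : {set I} | (i \notin S) && rainbow f S)
      \sum_(t | triple_in S t) \sum_(v | crossing (upd f i v) i t) 1.
  rewrite /num_blocks (exchange_big_dep (fun S : {set I} => (i \notin S) && rainbow f S)) /=.
    apply: eq_bigr => S /andP[iS RS].
    transitivity (\sum_v \sum_(t | crossing (upd f i v) i t && triple_in S t) 1).
      apply: eq_big => [v|v _]; first by rewrite iS free_rainbow.
      by rewrite -sum1_card; apply: eq_bigl => t; rewrite inE.
    rewrite (exchange_big_dep (triple_in S)) /=; last by move=> v t _ /andP[].
    by apply: eq_bigr => t ->; apply: eq_bigl => v; rewrite andbT.
  by move=> v S _ /andP[iS]; rewrite iS free_rainbow.
rewrite big_distrl /=; apply: leq_sum => S /andP[iS RS].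
apply: leq_trans (_ : \sum_(t | triple_in S t) #|V| <= _); last first.
  rewrite sum_nat_const mul1n leq_mul2r; apply/orP; right.
  rewrite (_ : #|_| = #|setX (setX S S) S|).
    by rewrite !cardsX !expnS expn0 muln1 -mulnA !leq_mul ?Hs.
  by apply: eq_card => -[[a b] c]; rewrite !inE /= -andbA.
rewrite big_distrl /=; apply: leq_sum => -[[a b] c] /and3P[/= aS bS cS].
apply: leq_trans (col_deg (f a) (col (f b) (f c))).
have Ni x : x \in S -> x != i by move=> xS; apply: contraNneq iS => <-.
rewrite leq_mul2r sum1_card subset_leq_card ?orbT //; apply/subsetP => v.
rewrite !inE => /andP[_ /and4P[_ _ _ /=]].
by rewrite upd_same !upd_other ?Ni // col_sym.
Qed.

Lemma num_extendableE f i :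
  num_extendable f i = \sum_(S : {set I} | rainbow f S && (i \in S)) 1.
Proof.
rewrite (reindex_onto (fun S => i |: S) (fun S => S :\ i)) /=; last first.
  by move=> S /andP[_ iS]; rewrite setD1K.
rewrite /num_extendable -big_mkcondr /=; apply: eq_bigl => S.
rewrite setU11 andbT; have [R|] := boolP (rainbow f (i |: S)); last by rewrite andbF.
rewrite (rainbowS (subsetUr _ _) R) !andbT /=.
apply/idP/eqP => [iS|<-]; last by rewrite !inE eqxx.
by rewrite setU1K.
Qed.

(** Double counting of the pairs of a rainbow set and one of its elements. *)
Lemma sum_num_extendable f s :
  (forall S, rainbow f S -> #|S| <= s) ->
  \sum_i num_extendable f i <= s * \sum_(S : {set I} | rainbow f S) 1.
Proof.
move=> Hs; under eq_bigr do rewrite num_extendableE.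
rewrite (exchange_big_dep (rainbow f)) /=; last by move=> i S _ /andP[].
rewrite big_distrr /=; apply: leq_sum => S RS.
by rewrite RS sum1_card muln1 Hs.
Qed.

Lemma num_rainbowE f i :
  \sum_(S : {set I} | rainbow f S) 1 = num_avoiding f i + num_extendable f i.
Proof.
rewrite num_extendableE (bigID (fun S : {set I} => i \in S)) /= addnC.
by congr (_ + _); apply: eq_bigl => S; rewrite andbC.
Qed.

Lemma num_extendable_le f i : num_extendable f i <= num_avoiding f i.
Proof. by apply: leq_sum => S _; case: rainbow. Qed.

(* Resampling [f i] leaves the distribution of the rainbow sets avoiding [i]
   unchanged. *)
Lemma sum_ratio_blocks i s :
  (forall f S, rainbow f S -> #|S| <= s) ->
  (((\sum_f (num_blocks f i)%:R / (num_avoiding f i)%:R) * M%:R : rat) <=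
   (NF * s ^ 3)%:R)%R.
Proof.
move=> Hs.
have V0 : (0 < #|V|%:R :> rat)%R by rewrite ltr0n.
rewrite -(ler_pM2l V0) mulrA mulr_natl -sumrMnl.
under eq_bigr do rewrite -sumr_const.
rewrite -(big_upd _ i) /= mulr_suml.
have -> : (#|V|%:R * (NF * s ^ 3)%:R = \sum_(f : {ffun I -> V}) (#|V| * s ^ 3)%:R :> rat)%R.
  by rewrite sumr_const -[RHS]mulr_natr -!natrM mulnA mulnAC mulnA.
apply: ler_sum => f _; under eq_bigr do rewrite num_avoiding_upd.
rewrite -mulr_suml mulrAC ler_pdivrMr ?ltr0n ?num_avoiding_gt0 //.
rewrite -natr_sum -!natrM ler_nat.
by apply: leq_trans (sum_num_blocks _ (Hs f)) _; rewrite mulnC [s ^ 3 * _]mulnC.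
Qed.

(** Removing [i] is injective on the rainbow sets containing [i], so [num_avoiding] is at least half
    of [t]. Using [t] as a denominator common to all [i] costs the factor 2. *)
Lemma sum_ratio_extendable f s :
  (forall S, rainbow f S -> #|S| <= s) ->
  (\sum_i (num_extendable f i)%:R / (num_avoiding f i)%:R <= (2 * s)%:R :> rat)%R.
Proof.
move=> Hs; pose t := \sum_(S : {set I} | rainbow f S) 1.
have t0 : (0 < t%:R :> rat)%R.
  by rewrite ltr0n /t (bigD1 set0) //= rainbow0.
apply: (@le_trans _ _ (\sum_i (2 * num_extendable f i)%:R / t%:R)%R).
  apply: ler_sum => i _; rewrite ler_pdivrMr ?ltr0n ?num_avoiding_gt0 //.
  rewrite mulrAC ler_pdivlMr // -!natrM ler_nat /t (num_rainbowE f i).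
  by have := num_extendable_le f i; nia.
rewrite -mulr_suml ler_pdivrMr // -natr_sum -natrM ler_nat -big_distrr /= -mulnA leq_mul2l /=.
exact: sum_num_extendable.
Qed.

(** Divides [good_count] by [num_avoiding] and sums over all good pairs of a map and an index, which
    are at least half of all pairs. *)
Lemma average_count s Y :
  (forall f S, rainbow f S -> #|S| <= s) ->
  (forall i, 2 * #|[pred f | bad f i]| <= NF) ->
  Y * q * M <= 16 * q * s ^ 3 + 4 * s * Y * 2 ^ Y * M.
Proof.
move=> Hs Hbad.
have NF0 : 0 < NF.
  by have [v _] := card_gt0P V_gt0; apply/card_gt0P; exists [ffun=> v].
have cardE (T : finType) m : ((#|T| * m)%:R = \sum_(i : T) m%:R :> rat)%R.
  by rewrite sumr_const -[RHS]mulr_natr -natrM mulnC.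
pose B : rat := (\sum_i \sum_f (num_blocks f i)%:R / (num_avoiding f i)%:R)%R.
pose E : rat := (\sum_i \sum_f (num_extendable f i)%:R / (num_avoiding f i)%:R)%R.
have HB : (B * M%:R <= (q * (NF * s ^ 3))%:R)%R.
  rewrite /B mulr_suml cardE.
  by apply: ler_sum => i _; exact: sum_ratio_blocks Hs.
have HE : (E <= (NF * (2 * s))%:R)%R.
  rewrite /E exchange_big /= cardE.
  by apply: ler_sum => f _; exact: sum_ratio_extendable (Hs f).
pose good := \sum_i \sum_f (~~ bad f i : nat).
have Hgood : q * NF <= 2 * good.
  rewrite /good big_distrr /= -sum_nat_const; apply: leq_sum => i _.
  rewrite -big_mkcond /= sum1_card.
  have E' : #|[pred f | bad f i]| + #|[predC [pred f | bad f i]]| = NF := cardC _.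
  by move: (Hbad i); rewrite -E' !mul2n -!addnn leq_add2l leq_add2r.
have H : ((Y * good)%:R <= 8%:R * B + (Y * 2 ^ Y)%:R * E)%R.
  rewrite /good /B /E big_distrr natr_sum /= !mulr_sumr -big_split /=.
  apply: ler_sum => i _; rewrite big_distrr natr_sum /= !mulr_sumr -big_split /=.
  apply: ler_sum => f _; rewrite !mulrA -mulrDl ler_pdivlMr ?ltr0n ?num_avoiding_gt0 //.
  rewrite -!natrM -natrD ler_nat; have [b|/(good_count Y)] := boolP (bad f i) => /=.
    by rewrite muln0.
  by rewrite muln1.
rewrite -(leq_pmul2r NF0) -(ler_nat rat).
have M0 : (0 <= M%:R :> rat)%R by rewrite ler0n.
have W0 : (0 <= (Y * 2 ^ Y)%:R :> rat)%R by rewrite ler0n.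
apply: (@le_trans _ _ ((2 * (Y * good * M))%:R)%R).
  rewrite ler_nat; have := leq_mul (leqnn (Y * M)) Hgood.
  by clear; move: (NF) good => k g; lia.
apply: (@le_trans _ _ (2%:R * (8%:R * (B * M%:R) + (Y * 2 ^ Y)%:R * E * M%:R))%R).
  rewrite natrM ler_pM2l // natrM.
  by have := ler_wpM2r M0 H; rewrite mulrDl -(mulrA 8%:R)%R.
apply: (@le_trans _ _ ((2 * (8 * (q * (NF * s ^ 3)) + Y * 2 ^ Y * (NF * (2 * s)) * M))%:R)%R).
  rewrite [leRHS]natrM ler_pM2l // natrD; apply: lerD.
    by rewrite [leRHS]natrM ler_pM2l.
  by rewrite [leRHS]natrM ler_wpM2r // [leRHS]natrM ler_wpM2l.
rewrite ler_nat; apply: eq_leq; clear; move: (NF) (2 ^ Y) (s ^ 3) => k p r; lia.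
Qed.

(** * Existence of a large rainbow set *)

Lemma exists_rainbow s Y :
  0 < Y -> 2 ^ (16 * (Y + 4)) <= s -> 22 * s ^ 3 <= M * Y ->
  #|I| = s * 2 ^ (Y + 4) ->
  exists f S, rainbow f S /\ s <= #|S|.
Proof.
move=> Y0 sY MY cardI.
have [/existsP[f /existsP[S /andP[R leS]]]|H] :=
  boolP [exists f, exists S, rainbow f S && (s <= #|S|)]; first by exists f, S.
have Hs f S : rainbow f S -> #|S| <= s.
  move=> R; rewrite leqNgt; apply: contra H => ltS.
  by apply/existsP; exists f; apply/existsP; exists S; rewrite R ltnW.
have s0 : 0 < s by apply: leq_trans sY; rewrite expn_gt0.
have M0 : 0 < M by move: MY; rewrite lt0n; case: M => // ; have := expn_gt0 s 3; lia.
pose r := 2 ^ (Y + 4).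
have r0 : 0 < r by rewrite expn_gt0.
have rY : 16 * Y <= r.
  by rewrite /r expnD mulnC leq_mul // ltnW // ltn_expl.
have rs : r ^ 16 <= s by rewrite /r -expnM mulnC.
(* Here [352 = 16 * 22], the 16 coming from [16 * Y <= r]. *)
have Mr : 352 * s ^ 3 <= M * r.
  by have := leq_mul (leqnn M) rY; lia.
have Hbad i : 2 * #|[pred f | bad f i]| <= NF.
  have pw k l := power_le (k := k) (l := l) r0 rs Mr.
  apply: (union_bound_half M0 (leqnn _) (pw 1 2 erefl isT) (pw 2 5 erefl isT) (pw 3 8 erefl isT)).
  by rewrite /r -cardI; apply: card_bad.
have := average_count Y Hs Hbad; rewrite cardI.
have q0 : 0 < s * 2 ^ (Y + 4) by rewrite muln_gt0 s0 expn_gt0.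
move=> H1.
(* Since the sample size is [16 * s * 2 ^ Y], the last term of [average_count] is a quarter of its
   left side. What remains, [3 * M * Y <= 64 * s ^ 3], contradicts [22 * s ^ 3 <= M * Y]. *)
have H2 : s * 2 ^ (Y + 4) * (3 * (M * Y)) <= s * 2 ^ (Y + 4) * (64 * s ^ 3).
  move: H1; rewrite expnD (_ : 2 ^ 4 = 16) //.
  by move: (2 ^ Y) (s ^ 3) => p c; clear; nia.
rewrite leq_pmul2l // in H2.
have s3 : 0 < s ^ 3 by rewrite expn_gt0 s0.
by exfalso; move: s3 MY H2; move: (s ^ 3) (M * Y) => c w; clear; lia.
Qed.

End RandomMap.

(* The sampled map [f] may fail to be injective, but a collision inside a rainbow
   set with a third element would create two edges of the same colour. *)
Lemma exists_rainbow_map (V C : finType) (col : V -> V -> C) M s Y :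
  (forall x y, col x y = col y x) ->
  (forall v c, #|[set w | col v w == c]| * M <= #|V|) -> 0 < #|V| ->
  0 < Y -> 2 ^ (16 * (Y + 4)) <= s -> 22 * s ^ 3 <= M * Y ->
  exists g : 'I_s -> V, injective g /\
    forall a b c d, a != b -> c != d -> col (g a) (g b) = col (g c) (g d) ->
      [set a; b] = [set c; d].
Proof.
move=> col_sym col_deg V0 Y0 sY MY.
have [f [S [/rainbowP R leS]]] := exists_rainbow (I := 'I_(s * 2 ^ (Y + 4)))
  col_sym col_deg V0 Y0 sY MY (card_ord _).
pose h (j : 'I_s) : 'I_(s * 2 ^ (Y + 4)) := enum_val (widen_ord leS j).
have hI : injective h by move=> a b /enum_val_inj/(congr1 val)/= /val_inj.
have hS j : h j \in S by apply: enum_valP.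
have sub a b c d : {subset [:: h a; h b; h c; h d] <= S}.
  by move=> x; rewrite !inE => /or4P[] /eqP ->.
have h2 a b : [set h a; h b] = h @: [set a; b] by rewrite imsetU !imset_set1.
have s3 : 2 < s.
  by apply: leq_trans sY; rewrite (@leq_trans (2 ^ 2)) // leq_pexp2l //; lia.
exists (fun j => f (h j)); split=> [a b E|a b c d ab cd E]; last first.
  have := R _ _ _ _ (sub a b c d).
  rewrite /conflict !(inj_eq hI) ab cd E eqxx andbT negbK !h2.
  by move/eqP/(imset_inj hI).
apply/eqP/negPn/negP => ab.
have [c cP] : exists c, c \notin [set a; b].
  apply/existsP; rewrite -negb_forall; apply/negP => /forallP H.
  have := subset_leq_card (introT subsetP (fun x _ => H x) : [set: 'I_s] \subset [set a; b]).
  by rewrite cardsT card_ord cards2 ab; lia.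
move: cP; rewrite !inE negb_or => /andP[ca cb].
have := R _ _ _ _ (sub a c b c).
rewrite /conflict !(inj_eq hI) E eqxx andbT [a == c]eq_sym ca [b == c]eq_sym cb /= negbK !h2.
move/eqP/(imset_inj hI)/setP/(_ a); rewrite !inE eqxx (negbTE ab) eq_sym (negbTE ca).
by [].
Qed.

(** * Chase into large colour neighbourhoods *)

Section Chase.

Variables (T D : finType) (e : T -> T -> D) (M s Y : nat).
Hypothesis e_sym : forall x y, e x y = e y x.
Hypothesis D_gt0 : 0 < #|D|.
Hypothesis Y_gt0 : 0 < Y.
Hypothesis sY : 2 ^ (16 * (Y + 4)) <= s.
Hypothesis MY : 22 * s ^ 3 <= M * Y.
Hypothesis no_rainbow : ~ exists g : 'I_s -> T, injective g /\
    forall a b c d, a != b -> c != d -> e (g a) (g b) = e (g c) (g d) ->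
      [set a; b] = [set c; d].

(** Otherwise [exists_rainbow_map], applied to the colouring restricted to [W], yields the excluded
    rainbow copy. The bound [M <= #|W|] takes care of the diagonal colour. *)
Lemma exists_large_degree (W : {set T}) :
  0 < #|W| -> M <= #|W| ->
  exists v d, v \in W /\ #|W| < #|[set w in W | (w != v) && (e v w == d)]| * M.
Proof.
move=> W0 MW.
have [/existsP[v /existsP[d /andP[vW H]]]|/existsPn H] := boolP [exists v, exists d,
  (v \in W) && (#|W| < #|[set w in W | (w != v) && (e v w == d)]| * M)]; first by exists v, d.
case: no_rainbow.
(* The extra colour [None] on the diagonal makes [col] total with degree 1. *)
pose col (x y : {x | x \in W}) := if x == y then None else Some (e (val x) (val y)).
have cardV : #|{: {x | x \in W}}| = #|W| by rewrite card_sig.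
have [] := @exists_rainbow_map _ _ col M s Y _ _ _ Y_gt0 sY MY.
- by move=> x y; rewrite /col eq_sym e_sym.
- rewrite cardV => v [d|].
    have /existsPn/(_ d) := H (val v); rewrite (valP v) /= -leqNgt; apply: leq_trans.
    rewrite leq_mul2r -(card_imset _ val_inj) subset_leq_card ?orbT //.
    apply/subsetP => x /imsetP[w wP ->]; rewrite inE in wP; move: wP; rewrite /col.
    case: (eqVneq v w) => [//|vw] /eqP[<-].
    by rewrite inE (valP w) eqxx andbT (inj_eq val_inj) eq_sym.
  rewrite (_ : [set w | col v w == None] = [set v]) ?cards1 ?mul1n //.
  by apply/setP => w; rewrite !inE /col; case: (eqVneq v w).
- by rewrite cardV.
move=> g [gI gR]; exists (fun j => val (g j)); split=> [a b /val_inj/gI //|a b c d ab cd E].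
by apply: gR => //; rewrite /col !(inj_eq gI) (negbTE ab) (negbTE cd) E.
Qed.

(** Each colour has its own target [tau d]. Passing to a large neighbourhood of [v] in colour [d]
    loses a factor less than [M] and lowers [tau d] by one; a set found there in colour [d] is
    enlarged by [v]. *)
Lemma exists_monochromatic (tau : D -> nat) (W : {set T}) :
  M ^ (\sum_d tau d) <= #|W| ->
  exists d (X : {set T}), [/\ X \subset W, tau d <= #|X|
    & {in X &, forall x y, x != y -> e x y = d}].
Proof.
have M0 : 0 < M.
  have s0 : 0 < s by apply: leq_trans sY; rewrite expn_gt0.
  by move: MY; rewrite lt0n; case: M => // ; have := expn_gt0 s 3; rewrite s0; case: (s ^ 3).
elim: {tau}(\sum_d tau d) {-2}tau (erefl (\sum_d tau d)) W => [|m IH] tau tauE W leW.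
  have [d _] := card_gt0P D_gt0; exists d, set0; split; rewrite ?sub0set //.
    by move/eqP: tauE; rewrite sum_nat_eq0 => /forallP/(_ d)/eqP ->.
  by move=> x y; rewrite inE.
have [/existsP[d /eqP d0]|/existsPn tau0] := boolP [exists d, tau d == 0].
  by exists d, set0; split; rewrite ?sub0set ?d0 // => x y; rewrite inE.
rewrite tauE in leW.
have [||v [d [vW Hd]]] := @exists_large_degree W.
- by apply: leq_trans leW; rewrite expn_gt0 M0.
- by apply: leq_trans leW; rewrite expnS leq_pmulr // expn_gt0 M0.
set W' := [set w in W | _] in Hd.
have leW' : M ^ m <= #|W'|.
  rewrite -(leq_pmul2r M0) -expnSr; exact: leq_trans leW (ltnW Hd).
pose tau' d' := if d' == d then (tau d).-1 else tau d'.
have tau'E : \sum_d tau' d = m.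
  apply: succn_inj; rewrite -tauE (bigD1 d) //= [in RHS](bigD1 d) //= /tau' eqxx.
  rewrite -addSn prednK ?lt0n ?tau0 //; congr (_ + _).
  by apply: eq_bigr => d' /negbTE ->.
rewrite -tau'E in leW'; have [d' [X [XW' tX mX]]] := IH tau' tau'E W' leW'.
have XW : X \subset W.
  by apply: subset_trans XW' _; apply/subsetP => w; rewrite inE => /andP[].
move: tX; rewrite /tau'; case: eqP => [E|_] tX; last by exists d', X.
exists d, (v |: X); split.
- by rewrite subUset sub1set vW.
- rewrite cardsU1 (_ : v \notin X); first by rewrite -[tau d]prednK ?lt0n ?tau0.
  by apply/negP => /(subsetP XW'); rewrite !inE eqxx andbF.
have vX x : x \in X -> e v x = d.
  by move/(subsetP XW'); rewrite inE => /and3P[_ _ /eqP].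
move=> x y; rewrite !inE => /predU1P[->|xX] /predU1P[->|yX]; rewrite ?eqxx // => xy.
- exact: vX.
- by rewrite e_sym vX.
- by rewrite -E mX.
Qed.

End Chase.

(** * The bound for complete graphs and the choice of constants *)

(** The chase is run with target [t] for each of the [k] colours, so the targets sum to [k * t]. *)
Lemma gallai_ramsey_complete k s t M Y :
  0 < k -> 0 < Y -> 2 ^ (16 * (Y + 4)) <= s -> 22 * s ^ 3 <= M * Y ->
  gallai_ramsey_property k (K s) (K t) (M ^ (k * t)).
Proof.
move=> k0 Y0 sY MY c; set n := M ^ (k * t) in c *.
have [|no_rainbow] := EM (has_rainbow_copy c (K s)); [by left | right].
pose e (x y : 'I_n) := c [set x; y].
have e_sym x y : e x y = e y x by rewrite /e setUC.
have edgesP m (E : {set K m}) :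
    E \in edges (K m) -> exists2 p : 'I_m * 'I_m, p.1 != p.2 & E = [set p.1; p.2].
  by rewrite inE => /existsP[a /existsP[b /andP[ab /eqP ->]]]; exists (a, b).
have copy m (g : 'I_m -> 'I_n) : injective g -> @is_copy (K m) (K n) g.
  by move=> gI; split=> // x y; rewrite /= /complete_rel (inj_eq gI).
have imset_pair m (g : 'I_m -> 'I_n) a b : [set g x | x in [set a; b]] = [set g a; g b].
  by rewrite imsetU !imset_set1.
have k0' : 0 < #|'I_k| by rewrite card_ord.
have [||d [X [_ tX mX]]] := exists_monochromatic e_sym k0' Y0 sY MY _ (tau := fun=> t)
  (W := [set: 'I_n]).
- move=> [g [gI gR]]; apply: no_rainbow; exists g; split; first exact: copy.
  move=> _ _ /edgesP[[a b] /= ab ->] /edgesP[[a' b'] /= ab' ->].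
  by rewrite !imset_pair; apply: gR.
- by rewrite sum_nat_const cardsT !card_ord.
pose g (j : 'I_t) : 'I_n := enum_val (widen_ord tX j).
have gI : injective g by move=> a b /enum_val_inj/(congr1 val)/= /val_inj.
exists g; split; first exact: copy.
move=> _ _ /edgesP[[a b] /= ab ->] /edgesP[[a' b'] /= ab' ->].
rewrite !imset_pair -![c _]/(e _ _).
by rewrite !mX ?enum_valP ?(inj_eq gI).
Qed.

Local Open Scope ring_scope.

Lemma ln_nat_le (R : realType) (n m : nat) :
  (0 < n)%N -> (n <= 2 ^ m)%N -> ln (n%:R : R) <= m%:R.
Proof.
move=> n0 nm.
have ln2 : ln (2 : R) <= 1.
  by have := @le_ln1Dx R 1; rewrite -[1 + 1]/(2%:R); apply; lra.
apply: (@le_trans _ _ (ln ((2 : R) ^+ m))).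
  by rewrite -natrX ler_ln ?posrE ?ltr0n ?expn_gt0 // ler_nat.
by rewrite lnXn // lerMn2r ln2 orbT.
Qed.

Theorem corollary1p12 (R : realType) :
  exists (c : R) (s0 : nat), 0 < c /\
    forall s k t : nat, (s0 <= s)%N -> (0 < k)%N -> (0 < t)%N ->
      exists n : nat, is_gallai_ramsey k (K s) (K t) n /\
        n%:R <= (c * s%:R ^+ 3 / ln (s%:R : R)) ^+ (k * t).
Proof.
(* [C] is kept opaque so that the numeral is not unfolded. The factor 23 bounds [M * Y / s ^ 3], the
   factor 96 bounds [L.+1 / Y]. *)
have [C CE] : {C | C = (96 * 23)%N} by exists (96 * 23)%N.
exists C%:R, (2 ^ (16 * 5))%N; split=> [|s k t s0 k0 _]; first by rewrite CE ltr0n.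
have s1 : (1 < s)%N by apply: leq_trans s0; rewrite -[2%N]expn1 leq_pexp2l.
have s_gt0 : (0 < s)%N by apply: ltnW.
(* [Y] is the largest value with [2 ^ (16 * (Y + 4)) <= s]; the choice of [2 ^ 80] as threshold
   makes it positive. *)
pose L := trunc_log 2 s; pose Y := (L %/ 16 - 4)%N.
have L80 : (16 * 5 <= L)%N by apply: trunc_log_max.
have Y0 : (0 < Y)%N by rewrite /Y; lia.
have sY : (2 ^ (16 * (Y + 4)) <= s)%N.
  by apply: leq_trans (trunc_logP (ltnSn 1) s_gt0); rewrite leq_pexp2l // /Y -/L; lia.
(* [L.+1 <= 16 * (Y + 5) <= 96 * Y], as [Y >= 1]. *)
have LY : (L.+1 <= 96 * Y)%N by rewrite /Y; lia.
(* Rounding up adds at most [Y <= s ^ 3] to [M * Y], whence 23 in place of 22. *)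
pose M := (22 * s ^ 3 %/ Y).+1.
have MY : (22 * s ^ 3 <= M * Y)%N by rewrite ltnW // ltn_ceil.
have MY' : (M * Y <= 23 * s ^ 3)%N.
  have Ys : (Y <= s ^ 3)%N.
    apply: leq_trans (_ : L <= _)%N; first by rewrite /Y; lia.
    apply: leq_trans (_ : s <= _)%N; last by rewrite -[leqLHS]expn1 leq_pexp2l.
    by apply: leq_trans (trunc_logP (ltnSn 1) s_gt0); rewrite ltnW // ltn_expl.
  by rewrite /M mulSn; have := leq_trunc_div (22 * s ^ 3) Y; lia.
have P := gallai_ramsey_complete (t := t) k0 Y0 sY MY.
(* The value [M ^ (k * t)] also shows that the minimum defining the Gallai-Ramsey number exists. *)
have exP : exists n, `[< gallai_ramsey_property k (K s) (K t) n >].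
  by exists (M ^ (k * t))%N; apply/asboolP.
case: (ex_minnP exP) => n /asboolP Pn min_n.
exists n; split; first by split=> // m Pm; apply: min_n; apply/asboolP.
have lns0 : 0 < ln (s%:R : R) by rewrite ln_gt0 // ltr1n.
apply: (@le_trans _ _ ((M ^ (k * t))%:R)).
  by rewrite ler_nat; apply: min_n; apply/asboolP.
rewrite natrX; apply: lerXn2r; rewrite ?nnegrE ?ler0n //.
  by rewrite divr_ge0 ?mulr_ge0 ?exprn_ge0 ?ler0n // ltW.
rewrite ler_pdivlMr // -natrX -natrM.
apply: (@le_trans _ _ (M%:R * (96 * Y)%:R)).
  rewrite ler_wpM2l ?ler0n //; apply: le_trans (_ : L.+1%:R <= _); last by rewrite ler_nat.
  by apply: ln_nat_le => //; rewrite ltnW // trunc_log_ltn.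
rewrite -natrM ler_nat.
by rewrite CE mulnCA -mulnA leq_mul2l MY'.
Qed.
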